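(* Let $c=\tfrac{\sqrt6}{3}$ (the octahedron case). Among all $G^1$-admissible quartic patches $\boldsymbol{p}$ (in the sense of the context, with real parameters $\alpha,\beta,\gamma,\zeta,\xi$), the simplified radial error $d_s(\boldsymbol{p})$ attains its minimum at the patch with $$\gamma=\frac{47+36\sqrt{974}}{1510},$$ and the radial error $d_r(\boldsymbol{p})$ attains its minimum at the patch with $$\gamma=\frac{1}{538}\left(209+768\sqrt3-12\sqrt{6126+1512\sqrt3}\right),$$ where in both cases the other parameters are given by $$\alpha=\frac{(6c^2-4)\gamma+c^2+2}{4c^2},\quad \beta=\frac{2\gamma-1}{2c^2},\quad \zeta=\frac{-4(9c^4-18c^2+8)\gamma+9c^6-24c^4-4c^2+16}{12c^2(3c^4-7c^2+4)},\quad \xi=\frac{-2(3c^4-3c^2-2)\gamma-c^2-2}{12c^2(1-c^2)}.$$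
   Context: $\Delta=\{(u,v)\in\mathbb{R}^2:\ 0\le u,v\le 1,\ v\le 1-u\}$ and $\|\cdot\|$ is the Euclidean norm. Let $\boldsymbol{v}_0=(c,0,\sqrt{1-c^2})^T$, $\boldsymbol{v}_1=(-\tfrac12c,\tfrac{\sqrt3}{2}c,\sqrt{1-c^2})^T$, $\boldsymbol{v}_2=(-\tfrac12c,-\tfrac{\sqrt3}{2}c,\sqrt{1-c^2})^T$ be the vertices of an equilateral spherical triangle on the unit sphere. The quartic patch is $\boldsymbol{p}:\Delta\to\mathbb{R}^3$, $\boldsymbol{p}(u,v)=\sum_{i+j+k=4}\frac{4!}{i!j!k!}u^iv^j(1-u-v)^k\,\boldsymbol{b}_{i,j,k}$ (with $i,j,k$ nonnegative integers), where $\boldsymbol{b}_{4,0,0}=\boldsymbol{v}_0$, $\boldsymbol{b}_{0,4,0}=\boldsymbol{v}_1$, $\boldsymbol{b}_{0,0,4}=\boldsymbol{v}_2$, $\boldsymbol{b}_{3,1,0}=\alpha\boldsymbol{v}_0+\beta\boldsymbol{v}_1$, $\boldsymbol{b}_{2,2,0}=\gamma(\boldsymbol{v}_0+\boldsymbol{v}_1)$, $\boldsymbol{b}_{2,1,1}=\zeta\boldsymbol{v}_0+\xi(\boldsymbol{v}_1+\boldsymbol{v}_2)$, and the remaining control points are obtained from these by symmetry, i.e. by applying the same permutation to the three index positions and to $(\boldsymbol{v}_0,\boldsymbol{v}_1,\boldsymbol{v}_2)$ (for instance $\boldsymbol{b}_{1,3,0}=\alpha\boldsymbol{v}_1+\beta\boldsymbol{v}_0$,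 $\boldsymbol{b}_{0,2,2}=\gamma(\boldsymbol{v}_1+\boldsymbol{v}_2)$, $\boldsymbol{b}_{1,2,1}=\zeta\boldsymbol{v}_1+\xi(\boldsymbol{v}_0+\boldsymbol{v}_2)$). The patch is called $G^1$-admissible if: (1) it is regular: $\partial_u\boldsymbol{p}$ and $\partial_v\boldsymbol{p}$ are linearly independent at every point of $\Delta$; (2) at each of the three vertices $\boldsymbol{v}_m$ of the patch, the normal of the tangent plane of the patch is parallel to $\boldsymbol{v}_m$; (3) at every point of each of the three boundary curves of the patch, the normal $\partial_u\boldsymbol{p}\times\partial_v\boldsymbol{p}$ lies in the plane through the origin and the two endpoints of that boundary curve. Errors: $d_s(\boldsymbol{p})=\max_{(u,v)\in\Delta}\big|\|\boldsymbol{p}(u,v)\|^2-1\big|$ and $d_r(\boldsymbol{p})=\max_{(u,v)\in\Delta}\big|\|\boldsymbol{p}(u,v)\|-1\big|$. *)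

(* Defs.v *)
From Stdlib Require Import Reals Factorial.
From Coquelicot Require Import Coquelicot.
Open Scope R_scope.

(* Space vectors ((x, y), z).  Addition, scaling and norm are those that
   Coquelicot puts on products; its product norm is the Euclidean one. *)
Definition vec : Type := (R * R * R)%type.

Lemma norm_vec (x y z : R) : norm ((x, y, z) : vec) = sqrt (x ^ 2 + y ^ 2 + z ^ 2).
Proof.
unfold norm; simpl; unfold prod_norm, norm; simpl; unfold prod_norm, norm; simpl.
unfold abs; simpl.
f_equal.
rewrite !Rmult_1_r, sqrt_sqrt, <- !Rabs_mult, !Rabs_right; try reflexivity;
  try (apply Rle_ge; apply Rle_0_sqr).
apply Rplus_le_le_0_compat; rewrite <- Rabs_mult; apply Rabs_pos.
Qed.

Definition cross (a b : vec) : vec :=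
  let '(a1, a2, a3) := a in
  let '(b1, b2, b3) := b in
  (a2 * b3 - a3 * b2, a3 * b1 - a1 * b3, a1 * b2 - a2 * b1).

Definition lin_indep (a b : vec) : Prop :=
  forall s t : R, plus (scal s a) (scal t b) = zero -> s = 0 /\ t = 0.

Definition parallel (n v : vec) : Prop := exists s : R, n = scal s v.

Definition in_plane (n v w : vec) : Prop :=
  exists s t : R, n = plus (scal s v) (scal t w).

Definition Derive_vec (f : R -> vec) (t : R) : vec :=
  (Derive (fun s => fst (fst (f s))) t,
   Derive (fun s => snd (fst (f s))) t,
   Derive (fun s => snd (f s)) t).

(* Patches are used as functions on the whole plane, so that the derivatives
   on the boundary of Delta are those of the polynomial extension. *)
Definition d_u (p : R -> R -> vec) (u v : R) : vec := Derive_vec (fun s => p s v) u.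
Definition d_v (p : R -> R -> vec) (u v : R) : vec := Derive_vec (fun s => p u s) v.

Definition normal (p : R -> R -> vec) (u v : R) : vec :=
  cross (d_u p u v) (d_v p u v).

Definition Delta (u v : R) : Prop :=
  0 <= u <= 1 /\ 0 <= v <= 1 /\ v <= 1 - u.

Definition v0 (c : R) : vec := (c, 0, sqrt (1 - c ^ 2)).
Definition v1 (c : R) : vec := (- (1 / 2) * c, sqrt 3 / 2 * c, sqrt (1 - c ^ 2)).
Definition v2 (c : R) : vec := (- (1 / 2) * c, - (sqrt 3 / 2) * c, sqrt (1 - c ^ 2)).

Record params := Params { alpha : R; beta : R; gamma : R; zeta : R; xi : R }.

Definition control_point (c : R) (q : params) (i j k : nat) : vec :=
  let comb (x y z : R) : vec :=
    plus (plus (scal x (v0 c)) (scal y (v1 c))) (scal z (v2 c)) in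
  let (al, be, ga, ze, xi) := q in
  match i, j, k with
  | 4%nat, 0%nat, 0%nat => v0 c
  | 0%nat, 4%nat, 0%nat => v1 c
  | 0%nat, 0%nat, 4%nat => v2 c
  | 3%nat, 1%nat, 0%nat => comb al be 0
  | 1%nat, 3%nat, 0%nat => comb be al 0
  | 3%nat, 0%nat, 1%nat => comb al 0 be
  | 1%nat, 0%nat, 3%nat => comb be 0 al
  | 0%nat, 3%nat, 1%nat => comb 0 al be
  | 0%nat, 1%nat, 3%nat => comb 0 be al
  | 2%nat, 2%nat, 0%nat => comb ga ga 0
  | 2%nat, 0%nat, 2%nat => comb ga 0 ga
  | 0%nat, 2%nat, 2%nat => comb 0 ga ga
  | 2%nat, 1%nat, 1%nat => comb ze xi xi
  | 1%nat, 2%nat, 1%nat => comb xi ze xi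
  | 1%nat, 1%nat, 2%nat => comb xi xi ze
  | _, _, _ => zero (* not reached when i + j + k = 4 *)
  end.

(* Coquelicot's [sum_n a n] is a 0 + ... + a n, bound included. *)
Definition quartic_patch (c : R) (q : params) (u v : R) : vec :=
  sum_n (fun i => sum_n (fun j =>
    let k := (4 - i - j)%nat in
    scal (INR (fact 4) / (INR (fact i) * INR (fact j) * INR (fact k))
          * u ^ i * v ^ j * (1 - u - v) ^ k)
         (control_point c q i j k)) (4 - i)) 4.

(* The parameters (1,0), (0,1), (0,0) are mapped to v0, v1, v2. *)
Definition G1_admissible (c : R) (p : R -> R -> vec) : Prop :=
  (forall u v, Delta u v -> lin_indep (d_u p u v) (d_v p u v)) /\
  (parallel (normal p 1 0) (v0 c) /\
   parallel (normal p 0 1) (v1 c) /\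
   parallel (normal p 0 0) (v2 c)) /\
  (forall t, 0 <= t <= 1 ->
     in_plane (normal p t (1 - t)) (v0 c) (v1 c) /\
     in_plane (normal p t 0) (v0 c) (v2 c) /\
     in_plane (normal p 0 t) (v1 c) (v2 c)).

(* For continuous f this supremum is finite and attained, since Delta is
   compact. *)
Definition max_Delta (f : R -> R -> R) : R :=
  real (Lub_Rbar (fun y => exists u v, Delta u v /\ y = f u v)).

Definition d_s (p : R -> R -> vec) : R :=
  max_Delta (fun u v => Rabs (norm (p u v) ^ 2 - 1)).

Definition d_r (p : R -> R -> vec) : R :=
  max_Delta (fun u v => Rabs (norm (p u v) - 1)).

Definition attains_min_at (c : R) (err : (R -> R -> vec) -> R) (q : params) : Prop :=
  G1_admissible c (quartic_patch c q) /\
  forall q' : params, G1_admissible c (quartic_patch c q') ->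
    err (quartic_patch c q) <= err (quartic_patch c q').

Definition params_of_gamma (c ga : R) : params := {|
  alpha := ((6 * c ^ 2 - 4) * ga + c ^ 2 + 2) / (4 * c ^ 2);
  beta := (2 * ga - 1) / (2 * c ^ 2);
  gamma := ga;
  zeta := (- 4 * (9 * c ^ 4 - 18 * c ^ 2 + 8) * ga
           + 9 * c ^ 6 - 24 * c ^ 4 - 4 * c ^ 2 + 16)
          / (12 * c ^ 2 * (3 * c ^ 4 - 7 * c ^ 2 + 4));
  xi := (- 2 * (3 * c ^ 4 - 3 * c ^ 2 - 2) * ga - c ^ 2 - 2)
        / (12 * c ^ 2 * (1 - c ^ 2)) |}.

(* Main.v *)
(* For c^2 = 2/3 the vectors v_0, v_1, v_2 are orthonormal, so patches are handled by their
   coordinates in this frame.  The G^1 conditions force alpha = zeta = 1 and leave, besides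
   families that are singular at the edge midpoints, two one-parameter families, both with
   norms |1 + 6g| / (4 sqrt 2) at the edge midpoints and |8g - 1| / (3 sqrt 3) at the centre for
   a suitable g.  For the family of the theorem (g = gamma near 0.775) these two values are the
   minimum and the maximum of the norm over Delta.  Each stated gamma makes the errors at the
   two places equal with opposite signs, and moving g in either direction increases one of them. *)
From Stdlib Require Import Reals Lra Psatz.
From Coquelicot Require Import Coquelicot.
Require Import Defs.
Open Scope R_scope.

(** * Symmetric-function inequalities and the range of the squared norm *)

Lemma e2_le_third (a b w : R) : a + b + w = 1 -> a * b + b * w + w * a <= 1 / 3.
Proof.
intros H. assert (E : (a + b + w) ^ 2 - 3 * (a * b + b * w + w * a) =
  ((a - b) ^ 2 + (b - w) ^ 2 + (w - a) ^ 2) / 2) by field.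
rewrite H in E.
pose proof (pow2_ge_0 (a - b)). pose proof (pow2_ge_0 (b - w)).
pose proof (pow2_ge_0 (w - a)). lra.
Qed.

(** The previous inequality applied to the products [ab], [bw], [wa], whose pairwise products sum to
    [abw (a + b + w)]. *)
Lemma e3_le (a b w : R) : a + b + w = 1 ->
  3 * (a * b * w) <= (a * b + b * w + w * a) ^ 2.
Proof.
intros H.
assert (E : (a * b + b * w + w * a) ^ 2 - 3 * (a * b * w) * (a + b + w) =
  ((a * b - b * w) ^ 2 + (b * w - w * a) ^ 2 + (w * a - a * b) ^ 2) / 2) by field.
rewrite H in E.
pose proof (pow2_ge_0 (a * b - b * w)). pose proof (pow2_ge_0 (b * w - w * a)).
pose proof (pow2_ge_0 (w * a - a * b)). lra.
Qed.

(** Schur's inequality of degree four, here as an explicit sum of squares, so that no signs are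
    required. *)
Lemma schur4 (a b w : R) : a + b + w = 1 ->
  let e := a * b + b * w + w * a in (4 * e - 1) * (1 - e) <= 6 * (a * b * w).
Proof.
intros H e.
assert (E : 6 * (a * b * w) - (4 * e - 1) * (1 - e) =
  (((a - b) * (a + b - w)) ^ 2 + ((b - w) * (b + w - a)) ^ 2 + ((w - a) * (w + a - b)) ^ 2) / 2).
{ unfold e. replace w with (1 - a - b) by lra. field. }
pose proof (pow2_ge_0 ((a - b) * (a + b - w))). pose proof (pow2_ge_0 ((b - w) * (b + w - a))).
pose proof (pow2_ge_0 ((w - a) * (w + a - b))). lra.
Qed.

(* The squared norm of the patch with [k = 5 - 6 gamma], in terms of the elementary
   symmetric functions [e = ab + bw + wa] and [f = abw] of the barycentric coordinates. *)
Definition sqnorm_sym (k e f : R) : R :=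
  1 + (2 - 6 * k + k ^ 2) * e ^ 2 - 2 * k ^ 2 * e ^ 3
  + f * (- 4 + 12 * k - 2 * k ^ 2 + (8 - 24 * k + 10 * k ^ 2) * e - 12 * k ^ 2 * e ^ 2)
  + f ^ 2 * (12 - 30 * k + 27 * k ^ 2 - 18 * k ^ 2 * e).

(** The interval for [k = 5 - 6 * gamma] corresponds to [gamma] between 0.7751 and 0.7752, which
    encloses both optimal values. *)
Lemma ksqr_bounds (k : R) (Hk : 3488 / 10000 <= k <= 3494 / 10000) :
  1216 / 10000 <= k ^ 2 <= 1221 / 10000.
Proof. nra. Qed.

(** The coefficient of [f] is concave in [e], so its values at [e = 8/100] and [e = 1/3] decide;
    near [e = 0] it is negative. *)
Lemma sqnorm_sym_f1_ge0 (k e : R) (Hk : 3488 / 10000 <= k <= 3494 / 10000)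
  (He : 0 <= e <= 1 / 3) : 8 / 100 <= e ->
  0 <= - 4 + 12 * k - 2 * k ^ 2 + (8 - 24 * k + 10 * k ^ 2) * e - 12 * k ^ 2 * e ^ 2.
Proof.
intros He'.
pose proof (ksqr_bounds k Hk).
assert (0 <= (e - 8/100) * (1/3 - e)) by nra.
nra.
Qed.

Lemma sqnorm_sym_f2_bounds (k e : R) (Hk : 3488 / 10000 <= k <= 3494 / 10000)
  (He : 0 <= e <= 1 / 3) :
  4 <= 12 - 30 * k + 27 * k ^ 2 - 18 * k ^ 2 * e <= 5.
Proof. pose proof (ksqr_bounds k Hk). nra. Qed.

Lemma sqnorm_sym_ge (k e f : R) (Hk : 3488 / 10000 <= k <= 3494 / 10000)
  (He : 0 <= e <= 1 / 3) (Hf : 0 <= f) (Hfe : 3 * f <= e ^ 2)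
  (Hs : (4 * e - 1) * (1 - e) <= 6 * f) :
  (6 - k) ^ 2 / 32 <= sqnorm_sym k e f.
Proof.
pose proof (ksqr_bounds k Hk). pose proof (sqnorm_sym_f2_bounds k e Hk He) as N2.
unfold sqnorm_sym.
set (n1 := - 4 + _ - _ + _ - _). set (n2 := 12 - _ + _ - _). fold n2 in N2.
(* At [e = 1/4, f = 0] (edge midpoints) equality holds, and there the Schur bound on [f]
   is tangent to the level line, whence the factor [h ^ 2] in the second case. *)
destruct (Rle_lt_dec e (1 / 4)) as [He4 | He4].
(* For [f = 0] the gap to the bound vanishes at [e = 1/4]; [C] makes the remaining factor
   positive. *)
- assert (E0 : 1 + (2 - 6 * k + k ^ 2) * e ^ 2 - 2 * k ^ 2 * e ^ 3 - (6 - k) ^ 2 / 32 =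
    (1 / 4 - e) * (2 * k ^ 2 * (e ^ 2 + e / 4 + 1 / 16) - (2 - 6 * k + k ^ 2) * (e + 1 / 4)))
    by field.
  assert (C : 7 / 1000 <= 2 * k ^ 2 * (e ^ 2 + e / 4 + 1 / 16) - (2 - 6 * k + k ^ 2) * (e + 1 / 4))
    by nra.
  assert (0 <= f ^ 2 * n2) by (apply Rmult_le_pos; [apply pow2_ge_0 | lra]).
  destruct (Rle_lt_dec (8 / 100) e) as [He8 | He8].
  + pose proof (sqnorm_sym_f1_ge0 k e Hk He He8) as N1. fold n1 in N1. nra.
  (* Here [n1] may be negative, but [f <= e ^ 2 / 3] makes its contribution smaller than the gap
     from [E0] and [C]. *)
  + assert (- 6 / 100 <= n1) by (unfold n1; nra). nra.
- assert (0 <= n1) by (apply (sqnorm_sym_f1_ge0 k e Hk He); lra).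
  assert (0 <= (4 * e - 1) * (1 - e)) by nra.
  (* Since [n1] and [n2] are nonnegative, replacing [f] by its Schur lower bound only decreases the
     expression and leaves a polynomial in [e]. *)
  assert (E1 : (4 * e - 1) * (1 - e) / 6 * n1 <= f * n1) by nra.
  assert (E2 : ((4 * e - 1) * (1 - e) / 6) ^ 2 * n2 <= f ^ 2 * n2).
  { apply Rmult_le_compat_r; [lra | apply pow_incr; lra]. }
  set (h := e - 1 / 4).
  assert (E3 : 1 + (2 - 6 * k + k ^ 2) * e ^ 2 - 2 * k ^ 2 * e ^ 3
     + (4 * e - 1) * (1 - e) / 6 * n1 + ((4 * e - 1) * (1 - e) / 6) ^ 2 * n2 - (6 - k) ^ 2 / 32 =
     h ^ 2 * (31 / 3 - 59 / 2 * k + 175 / 24 * k ^ 2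
       - (40 / 3 - 36 * k + 181 / 6 * k ^ 2) * h
       + (16 / 3 - 40 / 3 * k + 30 * k ^ 2) * h ^ 2 - 8 * k ^ 2 * h ^ 3))
    by (unfold n1, n2, h; field).
  assert (Hh : 0 <= h <= 1 / 12) by (unfold h; lra).
  assert (C0 : 9 / 10 <= 31 / 3 - 59 / 2 * k + 175 / 24 * k ^ 2) by lra.
  assert (C1 : 40 / 3 - 36 * k + 181 / 6 * k ^ 2 <= 9 / 2) by lra.
  assert (C2 : 4 <= 16 / 3 - 40 / 3 * k + 30 * k ^ 2) by lra.
  assert (0 <= h ^ 2 <= 1 / 144) by nra.
  assert (0 <= h ^ 3 <= 1 / 1728) by nra.
  assert (C : 0 <= 31 / 3 - 59 / 2 * k + 175 / 24 * k ^ 2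
       - (40 / 3 - 36 * k + 181 / 6 * k ^ 2) * h
       + (16 / 3 - 40 / 3 * k + 30 * k ^ 2) * h ^ 2 - 8 * k ^ 2 * h ^ 3) by nra.
  assert (0 <= h ^ 2 * (31 / 3 - 59 / 2 * k + 175 / 24 * k ^ 2
       - (40 / 3 - 36 * k + 181 / 6 * k ^ 2) * h
       + (16 / 3 - 40 / 3 * k + 30 * k ^ 2) * h ^ 2 - 8 * k ^ 2 * h ^ 3))
    by (apply Rmult_le_pos; lra).
  lra.
Qed.

(** Equality holds at the centre, [e = 1/3] and [f = 1/27], where [3 * f <= e ^ 2] is sharp as well.
    Substituting [f = e ^ 2 / 3] therefore leaves a gap divisible by [1/3 - e]. *)
Lemma sqnorm_sym_le (k e f : R) (Hk : 3488 / 10000 <= k <= 3494 / 10000)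
  (He : 0 <= e <= 1 / 3) (Hf : 0 <= f) (Hfe : 3 * f <= e ^ 2) :
  sqnorm_sym k e f <= (17 - 4 * k) ^ 2 / 243.
Proof.
pose proof (ksqr_bounds k Hk). pose proof (sqnorm_sym_f2_bounds k e Hk He) as N2.
unfold sqnorm_sym.
set (n1 := - 4 + _ - _ + _ - _). set (n2 := 12 - _ + _ - _). fold n2 in N2.
(* Only one factor [f] is bounded at first, which leaves an expression linear in [f]. *)
assert (F2 : f ^ 2 * n2 <= f * (e ^ 2 / 3 * n2)).
{ replace (f ^ 2 * n2) with (f * (f * n2)) by ring.
  apply Rmult_le_compat_l; [lra | apply Rmult_le_compat_r; lra]. }
destruct (Rle_lt_dec (8 / 100) e) as [He8 | He8].
- pose proof (sqnorm_sym_f1_ge0 k e Hk He He8) as N1. fold n1 in N1.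
  assert (G : f * (n1 + e ^ 2 / 3 * n2) <= e ^ 2 / 3 * (n1 + e ^ 2 / 3 * n2)).
  { apply Rmult_le_compat_r; [nra | lra]. }
  assert (E : (17 - 4 * k) ^ 2 / 243 - (1 + (2 - 6 * k + k ^ 2) * e ^ 2 - 2 * k ^ 2 * e ^ 3
      + e ^ 2 / 3 * (n1 + e ^ 2 / 3 * n2)) =
    (1 / 3 - e) * ((46 - 136 * k + 16 * k ^ 2) / 81 * (1 + 3 * e)
       + (28 / 9 - 82 / 9 * k + 7 / 9 * k ^ 2) * e ^ 2
       + (4 / 3 - 10 / 3 * k - 5 / 3 * k ^ 2) * e ^ 3 - 2 * k ^ 2 * e ^ 4))
    by (unfold n1, n2; field).
  assert (C0 : 4 / 1000 <= (46 - 136 * k + 16 * k ^ 2) / 81) by lra.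
  assert (C2 : 1 / 100 <= 28 / 9 - 82 / 9 * k + 7 / 9 * k ^ 2) by lra.
  assert (C3 : - 4 / 100 <= 4 / 3 - 10 / 3 * k - 5 / 3 * k ^ 2) by lra.
  assert (0 <= e ^ 2 <= 1 / 9) by nra.
  assert (0 <= e ^ 3 <= 1 / 27) by nra.
  assert (0 <= e ^ 4 <= 1 / 81) by nra.
  assert (0 <= (1 / 3 - e) * ((46 - 136 * k + 16 * k ^ 2) / 81 * (1 + 3 * e)
       + (28 / 9 - 82 / 9 * k + 7 / 9 * k ^ 2) * e ^ 2
       + (4 / 3 - 10 / 3 * k - 5 / 3 * k ^ 2) * e ^ 3 - 2 * k ^ 2 * e ^ 4)).
  { apply Rmult_le_pos; [lra |].
    assert (4 / 1000 * (1 + 3 * e) <= (46 - 136 * k + 16 * k ^ 2) / 81 * (1 + 3 * e)) by nra.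
    assert (1 / 100 * e ^ 2 <= (28 / 9 - 82 / 9 * k + 7 / 9 * k ^ 2) * e ^ 2) by nra.
    assert (- 4 / 100 * e ^ 3 <= (4 / 3 - 10 / 3 * k - 5 / 3 * k ^ 2) * e ^ 3) by nra.
    assert (2 * k ^ 2 * e ^ 4 <= 2442 / 10000 * e ^ 4) by nra.
    assert (e ^ 3 <= e ^ 2 / 3) by nra.
    assert (e ^ 4 <= e ^ 2 / 9) by nra.
    assert (e ^ 2 <= e / 3) by nra.
    lra. }
  lra.
(* For small [e] the sign of [n1] is not fixed, but the squared norm stays below 1.001 and crude
   bounds suffice. *)
- assert (n1 <= 8 / 100) by (unfold n1; nra).
  assert (0 <= e ^ 2 <= 64 / 10000) by nra.
  assert (f * (n1 + e ^ 2 / 3 * n2) <= f * (12 / 100)) by (apply Rmult_le_compat_l; nra).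
  assert (0 <= k ^ 2 * e ^ 3) by (apply Rmult_le_pos; [lra | apply pow_le; lra]).
  assert ((2 - 6 * k + k ^ 2) * e ^ 2 <= 4 / 100 * e ^ 2) by (apply Rmult_le_compat_r; lra).
  assert (1001 / 1000 <= (17 - 4 * k) ^ 2 / 243) by lra.
  lra.
Qed.

(** * Vectors in coordinates with respect to [v0], [v1], [v2] *)

Definition frame (c x y z : R) : vec :=
  (c * (x - (y + z) / 2), sqrt 3 / 2 * c * (y - z), sqrt (1 - c ^ 2) * (x + y + z)).

Lemma vec_eq (x y z x' y' z' : R) :
  x = x' -> y = y' -> z = z' -> (x, y, z) = (x', y', z') :> vec.
Proof. now intros -> -> ->. Qed.

Lemma frame_v0 (c : R) : v0 c = frame c 1 0 0.
Proof. apply vec_eq; field. Qed.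

Lemma frame_v1 (c : R) : v1 c = frame c 0 1 0.
Proof. apply vec_eq; field. Qed.

Lemma frame_v2 (c : R) : v2 c = frame c 0 0 1.
Proof. apply vec_eq; field. Qed.

Lemma vec_plus (x y z x' y' z' : R) :
  plus ((x, y, z) : vec) ((x', y', z') : vec) = (x + x', y + y', z + z').
Proof. reflexivity. Qed.

Lemma vec_scal (a x y z : R) : scal a ((x, y, z) : vec) = (a * x, a * y, a * z).
Proof. reflexivity. Qed.

Lemma frame_plus (c x y z x' y' z' : R) :
  plus (frame c x y z) (frame c x' y' z') = frame c (x + x') (y + y') (z + z').
Proof. unfold frame. rewrite vec_plus. apply vec_eq; field. Qed.

Lemma frame_scal (c a x y z : R) :
  scal a (frame c x y z) = frame c (a * x) (a * y) (a * z).
Proof. unfold frame. rewrite vec_scal. apply vec_eq; field. Qed.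

Lemma frame_zero (c : R) : zero = frame c 0 0 0.
Proof. change (zero : vec) with ((0, 0, 0) : vec). apply vec_eq; field. Qed.

Lemma Derive_vec_frame (c t x' y' z' : R) (x y z : R -> R) :
  is_derive x t x' -> is_derive y t y' -> is_derive z t z' ->
  Derive_vec (fun s => frame c (x s) (y s) (z s)) t = frame c x' y' z'.
Proof.
intros Hx Hy Hz.
assert (Ex : ex_derive x t) by now exists x'.
assert (Ey : ex_derive y t) by now exists y'.
assert (Ez : ex_derive z t) by now exists z'.
apply is_derive_unique in Hx. apply is_derive_unique in Hy. apply is_derive_unique in Hz.
apply vec_eq; simpl; apply is_derive_unique; auto_derive; try tauto;
  change (Derive (fun r => x r) t) with (Derive x t);
  change (Derive (fun r => y r) t) with (Derive y t);
  change (Derive (fun r => z r) t) with (Derive z t);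
  rewrite ?Hx, ?Hy, ?Hz; field.
Qed.

(** * The patch and its partial derivatives in frame coordinates *)

(** The coefficient of [v0] in the patch at barycentric coordinates [(a, b, w)]; cyclic permutation
    gives the other two. *)
Definition coord (q : params) (a b w : R) : R :=
  a ^ 4 + 4 * alpha q * a ^ 3 * (b + w) + 6 * gamma q * a ^ 2 * (b ^ 2 + w ^ 2)
  + 4 * beta q * a * (b ^ 3 + w ^ 3) + 12 * zeta q * a ^ 2 * b * w
  + 12 * xi q * a * b * w * (b + w).

(* Partial derivatives of [coord] in its first two arguments; [coord q a b w] is symmetric in
   [b] and [w], so the third one is [coord2 q a w b]. *)
Definition coord1 (q : params) (a b w : R) : R :=
  4 * a ^ 3 + 12 * alpha q * a ^ 2 * (b + w) + 12 * gamma q * a * (b ^ 2 + w ^ 2)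
  + 4 * beta q * (b ^ 3 + w ^ 3) + 24 * zeta q * a * b * w
  + 12 * xi q * b * w * (b + w).

Definition coord2 (q : params) (a b w : R) : R :=
  4 * alpha q * a ^ 3 + 12 * gamma q * a ^ 2 * b + 12 * beta q * a * b ^ 2
  + 12 * zeta q * a ^ 2 * w + 12 * xi q * a * w * (2 * b + w).

Definition patch_uvw (c : R) (q : params) (a b w : R) : vec :=
  frame c (coord q a b w) (coord q b w a) (coord q w a b).

Lemma quartic_patch_frame (c : R) (q : params) (u v : R) :
  quartic_patch c q u v = patch_uvw c q u v (1 - u - v).
Proof.
destruct q as [al be ga ze xi].
unfold quartic_patch. rewrite !sum_Sn, !sum_O; simpl.
rewrite !sum_Sn, !sum_O; simpl.
rewrite frame_v0, frame_v1, frame_v2.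
repeat rewrite ?frame_scal, ?frame_plus.
unfold patch_uvw, coord; simpl.
f_equal; field.
Qed.

Lemma Derive_vec_ext (f g : R -> vec) (t : R) :
  (forall s, f s = g s) -> Derive_vec f t = Derive_vec g t.
Proof.
intros H. unfold Derive_vec.
f_equal; [f_equal |]; apply Derive_ext; intros s; now rewrite H.
Qed.

(** Chain rule with [w = 1 - u - v]: the partial derivative in [u] minus the one in [w]. *)
Lemma d_u_quartic_patch (c : R) (q : params) (u v : R) :
  let w := 1 - u - v in
  d_u (quartic_patch c q) u v =
  frame c (coord1 q u v w - coord2 q u w v) (coord2 q v u w - coord2 q v w u)
    (coord2 q w u v - coord1 q w u v).
Proof.
intros w. unfold d_u.
rewrite (Derive_vec_ext _ _ _ (fun s => quartic_patch_frame c q s v)).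
apply (Derive_vec_frame c u _ _ _ (fun s => coord q s v (1 - s - v))
  (fun s => coord q v (1 - s - v) s) (fun s => coord q (1 - s - v) s v));
  unfold coord, coord1, coord2; auto_derive; auto; unfold w; ring.
Qed.

Lemma d_v_quartic_patch (c : R) (q : params) (u v : R) :
  let w := 1 - u - v in
  d_v (quartic_patch c q) u v =
  frame c (coord2 q u v w - coord2 q u w v) (coord1 q v w u - coord2 q v w u)
    (coord2 q w v u - coord1 q w u v).
Proof.
intros w. unfold d_v.
rewrite (Derive_vec_ext _ _ _ (fun s => quartic_patch_frame c q u s)).
apply (Derive_vec_frame c v _ _ _ (fun s => coord q u s (1 - u - s))
  (fun s => coord q s (1 - u - s) u) (fun s => coord q (1 - u - s) u s));
  unfold coord, coord1, coord2; auto_derive; auto; unfold w; ring.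
Qed.

(** * The orthonormal frame of the octahedron case *)

Notation c_oct := (sqrt 6 / 3).

Lemma c_oct_sqr : c_oct ^ 2 = 2 / 3.
Proof. pose proof (pow2_sqrt 6). lra. Qed.

Lemma height_oct : sqrt (1 - c_oct ^ 2) = sqrt 3 / 3.
Proof.
rewrite c_oct_sqr.
replace (1 - 2 / 3) with ((sqrt 3 / 3) ^ 2) by (pose proof (pow2_sqrt 3); lra).
apply sqrt_pow2. pose proof (sqrt_pos 3). lra.
Qed.

Lemma norm_frame (x y z : R) : norm (frame c_oct x y z) = sqrt (x ^ 2 + y ^ 2 + z ^ 2).
Proof.
unfold frame. rewrite norm_vec, height_oct. f_equal.
pose proof c_oct_sqr as Hc. assert (Hs : sqrt 3 ^ 2 = 3) by (apply pow2_sqrt; lra).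
set (c := c_oct) in *. set (s := sqrt 3) in *.
replace ((c * (x - (y + z) / 2)) ^ 2 + (s / 2 * c * (y - z)) ^ 2 + (s / 3 * (x + y + z)) ^ 2)
  with (c ^ 2 * (x - (y + z) / 2) ^ 2 + s ^ 2 * c ^ 2 * (y - z) ^ 2 / 4
        + s ^ 2 * (x + y + z) ^ 2 / 9) by field.
rewrite Hc, Hs. field.
Qed.

(** The frame is orthonormal and positively oriented, so the usual coordinate formula survives. *)
Lemma cross_frame (x y z x' y' z' : R) :
  cross (frame c_oct x y z) (frame c_oct x' y' z') =
  frame c_oct (y * z' - z * y') (z * x' - x * z') (x * y' - y * x').
Proof.
unfold frame, cross. rewrite height_oct.
pose proof c_oct_sqr as Hc. assert (Hs : sqrt 3 ^ 2 = 3) by (apply pow2_sqrt; lra).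
set (c := c_oct) in *. set (s := sqrt 3) in *.
apply vec_eq.
- transitivity (s ^ 2 * (c / 6 * ((y - z) * (x' + y' + z') - (x + y + z) * (y' - z')))); [field |].
  rewrite Hs. field.
- field.
- transitivity (c ^ 2 * (s / 2 * ((x - (y + z) / 2) * (y' - z') - (y - z) * (x' - (y' + z') / 2))));
    [field |].
  rewrite Hc. field.
Qed.

Lemma frame_inj (x y z x' y' z' : R) :
  frame c_oct x y z = frame c_oct x' y' z' -> x = x' /\ y = y' /\ z = z'.
Proof.
intros H.
assert (P : 0 < sqrt 6 / 3) by (pose proof (sqrt_lt_R0 6); lra).
assert (Q : 0 < sqrt 3) by (apply sqrt_lt_R0; lra).
unfold frame in H. rewrite height_oct in H. injection H as H1 H2 H3.
apply Rmult_eq_reg_l in H1; [| lra].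
apply Rmult_eq_reg_l in H2; [| apply Rgt_not_eq, Rmult_lt_0_compat; lra].
apply Rmult_eq_reg_l in H3; lra.
Qed.

(** The sum is the determinant of the two coordinate vectors and [(1, 1, 1)], and Cramer's rule
    isolates [s] and [t]. A single scalar thus suffices to prove regularity. *)
Lemma lin_indep_frame (x y z x' y' z' : R) :
  (y * z' - z * y') + (z * x' - x * z') + (x * y' - y * x') <> 0 ->
  lin_indep (frame c_oct x y z) (frame c_oct x' y' z').
Proof.
intros HD s t. rewrite !frame_scal, frame_plus.
intros H. pose proof (eq_trans H (frame_zero c_oct)) as H0. apply frame_inj in H0.
destruct H0 as (H1 & H2 & H3).
split; apply (Rmult_eq_reg_r ((y * z' - z * y') + (z * x' - x * z') + (x * y' - y * x')));
  try exact HD.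
- transitivity ((s * x + t * x') * (y' - z') + (s * y + t * y') * (z' - x')
    + (s * z + t * z') * (x' - y')); [ring | rewrite H1, H2, H3; ring].
- transitivity ((s * x + t * x') * (z - y) + (s * y + t * y') * (x - z)
    + (s * z + t * z') * (y - x)); [ring | rewrite H1, H2, H3; ring].
Qed.

Lemma parallel_frame_v0 (x y z : R) : parallel (frame c_oct x y z) (v0 c_oct) <-> y = 0 /\ z = 0.
Proof.
split.
- intros [s H]. rewrite frame_v0, frame_scal in H. apply frame_inj in H. lra.
- intros [-> ->]. exists x. rewrite frame_v0, frame_scal. f_equal; ring.
Qed.

Lemma parallel_frame_v1 (x y z : R) : parallel (frame c_oct x y z) (v1 c_oct) <-> x = 0 /\ z = 0.
Proof.
split.
- intros [s H]. rewrite frame_v1, frame_scal in H. apply frame_inj in H. lra.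
- intros [-> ->]. exists y. rewrite frame_v1, frame_scal. f_equal; ring.
Qed.

Lemma parallel_frame_v2 (x y z : R) : parallel (frame c_oct x y z) (v2 c_oct) <-> x = 0 /\ y = 0.
Proof.
split.
- intros [s H]. rewrite frame_v2, frame_scal in H. apply frame_inj in H. lra.
- intros [-> ->]. exists z. rewrite frame_v2, frame_scal. f_equal; ring.
Qed.

Lemma in_plane_frame_01 (x y z : R) : in_plane (frame c_oct x y z) (v0 c_oct) (v1 c_oct) <-> z = 0.
Proof.
rewrite frame_v0, frame_v1. split.
- intros (s & t & H). rewrite !frame_scal, frame_plus in H. apply frame_inj in H. lra.
- intros ->. exists x, y. rewrite !frame_scal, frame_plus. f_equal; ring.
Qed.

Lemma in_plane_frame_02 (x y z : R) : in_plane (frame c_oct x y z) (v0 c_oct) (v2 c_oct) <-> y = 0.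
Proof.
rewrite frame_v0, frame_v2. split.
- intros (s & t & H). rewrite !frame_scal, frame_plus in H. apply frame_inj in H. lra.
- intros ->. exists x, z. rewrite !frame_scal, frame_plus. f_equal; ring.
Qed.

Lemma in_plane_frame_12 (x y z : R) : in_plane (frame c_oct x y z) (v1 c_oct) (v2 c_oct) <-> x = 0.
Proof.
rewrite frame_v1, frame_v2. split.
- intros (s & t & H). rewrite !frame_scal, frame_plus in H. apply frame_inj in H. lra.
- intros ->. exists y, z. rewrite !frame_scal, frame_plus. f_equal; ring.
Qed.

(** * The family of the theorem: norm and admissibility *)

Lemma params_of_gamma_oct (g : R) :
  params_of_gamma c_oct g = Params 1 (3 * (2 * g - 1) / 4) g 1 (2 * g - 1).
Proof.
unfold params_of_gamma.
replace (c_oct ^ 4) with ((c_oct ^ 2) ^ 2) by ring.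
replace (c_oct ^ 6) with ((c_oct ^ 2) ^ 3) by ring.
rewrite c_oct_sqr. f_equal; field.
Qed.

Lemma norm_patch_sym (g u v : R) :
  let w := 1 - u - v in
  norm (quartic_patch c_oct (params_of_gamma c_oct g) u v) =
  sqrt (sqnorm_sym (5 - 6 * g) (u * v + v * w + w * u) (u * v * w)).
Proof.
intros w. rewrite quartic_patch_frame, params_of_gamma_oct. unfold patch_uvw.
rewrite norm_frame. f_equal.
unfold coord, sqnorm_sym, w; simpl. field.
Qed.

(** For regularity, the determinant with [(1, 1, 1)] is a polynomial in [e] and [f] with nonnegative
    coefficients when [k] lies in [0, 1], and its constant term is [(2 - k) ^ 2 >= 1]. The
    conditions on the normals are polynomial identities on this family. *)
Lemma admissible_params_of_gamma (g : R) : 2 / 3 <= g <= 5 / 6 ->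
  G1_admissible c_oct (quartic_patch c_oct (params_of_gamma c_oct g)).
Proof.
intros Hg. rewrite params_of_gamma_oct.
split; [| split; [split; [| split] | intros t _; split; [| split]]].
- intros u v H. rewrite d_u_quartic_patch, d_v_quartic_patch.
  apply lin_indep_frame. apply Rgt_not_eq.
  set (k := 5 - 6 * g). assert (Hk : 0 <= k <= 1) by (unfold k; lra).
  destruct H as ([Hu1 Hu2] & [Hv1 Hv2] & Hw).
  set (w := 1 - u - v). assert (Hw' : 0 <= w) by (unfold w; lra).
  set (e := u * v + v * w + w * u). set (f := u * v * w).
  assert (He : 0 <= e).
  { pose proof (Rmult_le_pos u v). pose proof (Rmult_le_pos v w).
    pose proof (Rmult_le_pos w u). unfold e; lra. }
  assert (Hf : 0 <= f) by (repeat apply Rmult_le_pos; auto).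
  match goal with |- ?x > 0 => replace x with
    ((2 - k) ^ 2 + (24 * k + 15 * k ^ 2) * f + 108 * k ^ 2 * f ^ 2 + (4 + 8 * k - 5 * k ^ 2) * e
     + 54 * k ^ 2 * e * f + (12 * k - 6 * k ^ 2) * e ^ 2) end.
  2:{ unfold coord1, coord2, e, f, w, k; simpl. field. }
  assert (0 <= (24 * k + 15 * k ^ 2) * f) by (apply Rmult_le_pos; nra).
  assert (0 <= 108 * k ^ 2 * f ^ 2) by (apply Rmult_le_pos; nra).
  assert (0 <= (4 + 8 * k - 5 * k ^ 2) * e) by (apply Rmult_le_pos; nra).
  assert (0 <= 54 * k ^ 2 * e * f) by (repeat apply Rmult_le_pos; nra).
  assert (0 <= (12 * k - 6 * k ^ 2) * e ^ 2) by (apply Rmult_le_pos; nra).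
  nra.
- unfold normal. rewrite d_u_quartic_patch, d_v_quartic_patch, cross_frame.
  apply parallel_frame_v0. unfold coord1, coord2; simpl. split; field.
- unfold normal. rewrite d_u_quartic_patch, d_v_quartic_patch, cross_frame.
  apply parallel_frame_v1. unfold coord1, coord2; simpl. split; field.
- unfold normal. rewrite d_u_quartic_patch, d_v_quartic_patch, cross_frame.
  apply parallel_frame_v2. unfold coord1, coord2; simpl. split; field.
- unfold normal. rewrite d_u_quartic_patch, d_v_quartic_patch, cross_frame.
  apply in_plane_frame_01. unfold coord1, coord2; simpl. field.
- unfold normal. rewrite d_u_quartic_patch, d_v_quartic_patch, cross_frame.
  apply in_plane_frame_02. unfold coord1, coord2; simpl. field.
- unfold normal. rewrite d_u_quartic_patch, d_v_quartic_patch, cross_frame.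
  apply in_plane_frame_12. unfold coord1, coord2; simpl. field.
Qed.

(** * Necessary conditions for admissibility *)

Lemma lin_indep_frame_inv (c x y z x' y' z' s t : R) :
  lin_indep (frame c x y z) (frame c x' y' z') ->
  s * x + t * x' = 0 -> s * y + t * y' = 0 -> s * z + t * z' = 0 -> s = 0 /\ t = 0.
Proof.
intros H Hx Hy Hz. apply H.
rewrite !frame_scal, frame_plus, Hx, Hy, Hz. symmetry. apply frame_zero.
Qed.

(** With [beta q = 0], [d_v] vanishes at the vertex [v0]. With [alpha q = 1] and [beta q = 3 / 2],
    the derivative along the edge [w = 0] vanishes at its midpoint. *)
Lemma regular_beta (c : R) (q : params) :
  (forall u v, Delta u v ->
     lin_indep (d_u (quartic_patch c q) u v) (d_v (quartic_patch c q) u v)) ->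
  beta q <> 0 /\ (alpha q = 1 -> beta q <> 3 / 2).
Proof.
intros H. split.
- intros Hb. specialize (H 1 0). rewrite d_u_quartic_patch, d_v_quartic_patch in H.
  apply (lin_indep_frame_inv _ _ _ _ _ _ _ 0 1) in H; [lra | ..];
    try (unfold coord1, coord2; rewrite Hb; ring).
  unfold Delta; lra.
- intros Ha Hb. specialize (H (1 / 2) (1 / 2)).
  rewrite d_u_quartic_patch, d_v_quartic_patch in H.
  apply (lin_indep_frame_inv _ _ _ _ _ _ _ 1 (-1)) in H; [lra | ..];
    try (unfold coord1, coord2; rewrite ?Ha, ?Hb; field).
  unfold Delta; lra.
Qed.

(* The third normal component along the edge [w = 0] is
   [16 t (1 - t) (c1 (t^4 + s^4) + c2 t s (t^2 + s^2) + c3 t^2 s^2)] with [s = 1 - t];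
   three values of [t] separate its coefficients. *)
Lemma admissible_equations (q : params) :
  G1_admissible c_oct (quartic_patch c_oct q) ->
  beta q <> 0 /\ alpha q = 1 /\ zeta q = 1 /\ beta q <> 3 / 2 /\
  (gamma q - xi q) * beta q = 3 * (gamma q - 1) * (beta q - xi q) /\
  beta q ^ 2 + 9 * (gamma q - xi q) ^ 2 =
  9 * (gamma q - 1) ^ 2 + 9 * (beta q - xi q) ^ 2.
Proof.
intros (Hreg & (Hv0 & _ & _) & Hedge).
destruct (regular_beta _ _ Hreg) as [Hb0 Hb].
assert (Ha : alpha q = 1).
{ unfold normal in Hv0. rewrite d_u_quartic_patch, d_v_quartic_patch, cross_frame in Hv0.
  apply parallel_frame_v0 in Hv0. destruct Hv0 as [Hv0 _].
  unfold coord1, coord2 in Hv0. ring_simplify in Hv0.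
  assert (E : beta q * (1 - alpha q) = 0) by lra.
  apply Rmult_integral in E. lra. }
set (c1 := 3 * (1 - zeta q) * beta q).
set (c2 := 3 * (gamma q - xi q) * beta q + 9 * (1 - zeta q) * (gamma q - xi q)
  - 9 * (gamma q - zeta q) * (beta q - xi q)).
set (c3 := beta q ^ 2 + 9 * (1 - zeta q) ^ 2 + 9 * (gamma q - xi q) ^ 2
  - 9 * (gamma q - zeta q) ^ 2 - 9 * (beta q - xi q) ^ 2).
assert (Hz : forall t, 0 <= t <= 1 -> let s := 1 - t in
  16 * (t * s) * (c1 * (t ^ 4 + s ^ 4) + c2 * (t * s) * (t ^ 2 + s ^ 2) + c3 * (t * s) ^ 2) = 0).
{ intros t Ht s. destruct (Hedge t Ht) as [E _].
  unfold normal in E. rewrite d_u_quartic_patch, d_v_quartic_patch, cross_frame in E.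
  apply in_plane_frame_01 in E. rewrite <- E.
  unfold coord1, coord2, c1, c2, c3, s. rewrite Ha. ring. }
assert (E1 := Hz (1 / 2) ltac:(lra)). assert (E2 := Hz (1 / 3) ltac:(lra)).
assert (E3 := Hz (1 / 4) ltac:(lra)). simpl in E1, E2, E3.
assert (C1 : c1 = 0) by lra. assert (C2 : c2 = 0) by lra. assert (C3 : c3 = 0) by lra.
assert (Hze : zeta q = 1).
{ unfold c1 in C1. assert (E : beta q * (1 - zeta q) = 0) by lra.
  apply Rmult_integral in E. lra. }
unfold c2 in C2. unfold c3 in C3. rewrite Hze in C2, C3.
repeat split; auto; lra.
Qed.

(* With [b = beta / 3], the two edge equations give [(b^2 - (beta - xi)^2) (b^2 - (gamma - 1)^2) = 0].
   Two of the four factors force [beta = 3/2]; the other two are the family of the theorem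
   and [beta = 3 (1 - gamma), xi = 3/2 - gamma], which has the same edge midpoints and centre
   as the member [5/4 - gamma/2] of the first one. *)
Lemma admissible_midpoint_center (q : params) :
  G1_admissible c_oct (quartic_patch c_oct q) ->
  exists g, coord q (1 / 2) (1 / 2) 0 = (1 + 6 * g) / 8 /\
    coord q (1 / 3) (1 / 3) (1 / 3) = (8 * g - 1) / 9.
Proof.
intros H. apply admissible_equations in H.
destruct H as (Hb0 & Ha & Hz & Hb & H1 & H2).
unfold coord. rewrite Ha, Hz.
set (b := beta q) in *. set (g := gamma q) in *. set (x := xi q) in *.
assert (E : (b - 3 * (b - x)) * (b + 3 * (b - x)) * ((b - 3 * (g - 1)) * (b + 3 * (g - 1))) = 0).
(* The second edge equation is multiplied by [b ^ 2], and [(g - x) * b] is eliminated with the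
   first. *)
{ transitivity (b ^ 2 * (b ^ 2 + 9 * (g - x) ^ 2 - 9 * (g - 1) ^ 2 - 9 * (b - x) ^ 2)
    - 9 * ((g - x) * b - 3 * (g - 1) * (b - x)) * ((g - x) * b + 3 * (g - 1) * (b - x))); [ring |].
  rewrite (Rminus_diag_eq _ _ H1).
  replace (b ^ 2 + _ - _ - _) with 0 by lra. ring. }
assert (K : forall y, b * y = 0 -> y = 0).
{ intros y Hy. apply Rmult_integral in Hy. tauto. }
apply Rmult_integral in E. destruct E as [E | E]; apply Rmult_integral in E; destruct E as [E | E].
- exfalso. assert (x = 2 * b / 3) by lra. assert (F : g - x - (g - 1) = 0) by (apply K; nra). lra.
- assert (x = 4 * b / 3) by lra. assert (F : g - x + (g - 1) = 0) by (apply K; nra).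
  exists g. split; lra.
- exfalso. assert (F : g - x - (b - x) = 0) by (apply K; nra). lra.
- assert (F : g - x + (b - x) = 0) by (apply K; nra).
  exists (5 / 4 - g / 2). split; lra.
Qed.

(** * Suprema over the triangle *)

(** [real] sends an infinite supremum to 0; the bound [B], whose size is irrelevant, excludes
    that. *)
Lemma Delta_le_max (f : R -> R -> R) (B u v : R) :
  (forall u v, Delta u v -> f u v <= B) -> Delta u v -> f u v <= max_Delta f.
Proof.
intros HB Huv. unfold max_Delta.
set (E := fun y => _). destruct (Lub_Rbar_correct E) as [Hub Hl].
assert (H1 : Rbar_le (f u v) (Lub_Rbar E)) by (apply Hub; exists u, v; auto).
assert (H2 : Rbar_le (Lub_Rbar E) B).
{ apply Hl. intros y (u' & v' & H & ->). now apply HB. }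
destruct (Lub_Rbar E); simpl in *; tauto.
Qed.

Lemma max_Delta_le (f : R -> R -> R) (B : R) :
  (forall u v, Delta u v -> f u v <= B) -> max_Delta f <= B.
Proof.
intros HB. unfold max_Delta.
set (E := fun y => _). destruct (Lub_Rbar_correct E) as [Hub Hl].
(* Any value of [f] keeps the supremum away from minus infinity. *)
assert (H1 : Rbar_le (f 0 0) (Lub_Rbar E)).
{ apply Hub. exists 0, 0. split; [unfold Delta; lra | reflexivity]. }
assert (H2 : Rbar_le (Lub_Rbar E) B).
{ apply Hl. intros y (u' & v' & H & ->). now apply HB. }
destruct (Lub_Rbar E); simpl in *; tauto.
Qed.

Lemma monomial_bound (A m : R) : 0 <= m <= 1 -> - Rabs A <= A * m <= Rabs A.
Proof.
intros Hm. pose proof (Rle_abs A). pose proof (Rle_abs (- A)). rewrite Rabs_Ropp in *.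
destruct (Rle_lt_dec 0 A); split; nra.
Qed.

(** A crude bound, enough to make the suprema of an arbitrary competitor finite. *)
Lemma coord_bound (q : params) : exists B, forall a b w,
  0 <= a <= 1 -> 0 <= b <= 1 -> 0 <= w <= 1 -> - B <= coord q a b w <= B.
Proof.
exists (1 + 8 * Rabs (alpha q) + 12 * Rabs (gamma q) + 8 * Rabs (beta q)
  + 12 * Rabs (zeta q) + 24 * Rabs (xi q)).
assert (M : forall x y, 0 <= x <= 1 -> 0 <= y <= 1 -> 0 <= x * y <= 1) by (intros; nra).
assert (Pw : forall x n, 0 <= x <= 1 -> 0 <= x ^ n <= 1).
{ intros x n Hx; induction n; simpl; [lra | auto]. }
intros a b w Ha Hb Hw. unfold coord.
pose proof (Pw a 4%nat Ha).
pose proof (monomial_bound (alpha q) (a ^ 3 * b) ltac:(auto)).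
pose proof (monomial_bound (alpha q) (a ^ 3 * w) ltac:(auto)).
pose proof (monomial_bound (gamma q) (a ^ 2 * b ^ 2) ltac:(auto)).
pose proof (monomial_bound (gamma q) (a ^ 2 * w ^ 2) ltac:(auto)).
pose proof (monomial_bound (beta q) (a * b ^ 3) ltac:(auto)).
pose proof (monomial_bound (beta q) (a * w ^ 3) ltac:(auto)).
pose proof (monomial_bound (zeta q) (a ^ 2 * (b * w)) ltac:(auto)).
pose proof (monomial_bound (xi q) (a * (b ^ 2 * w)) ltac:(auto)).
pose proof (monomial_bound (xi q) (a * (b * w ^ 2)) ltac:(auto)).
split; lra.
Qed.

Lemma norm_patch_bound (q : params) : exists K, forall u v, Delta u v ->
  0 <= norm (quartic_patch c_oct q u v) <= K.
Proof.
destruct (coord_bound q) as [B HB].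
exists (sqrt (3 * B ^ 2)). intros u v ([Hu1 Hu2] & [Hv1 Hv2] & Hw).
split; [apply norm_ge_0 |].
rewrite quartic_patch_frame. unfold patch_uvw. rewrite norm_frame.
apply sqrt_le_1_alt.
assert (S : forall x, - B <= x <= B -> x ^ 2 <= B ^ 2) by (intros; nra).
pose proof (S _ (HB u v (1 - u - v) ltac:(lra) ltac:(lra) ltac:(lra))).
pose proof (S _ (HB v (1 - u - v) u ltac:(lra) ltac:(lra) ltac:(lra))).
pose proof (S _ (HB (1 - u - v) u v ltac:(lra) ltac:(lra) ltac:(lra))).
lra.
Qed.

(** * Edge midpoint, centre and optimality *)

(** Two coordinates coincide and the third is 0, since every term of [coord q a b w] contains [a].
    At the centre all three coincide. *)
Lemma norm_patch_midpoint (q : params) :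
  norm (quartic_patch c_oct q (1 / 2) (1 / 2)) = Rabs (coord q (1 / 2) (1 / 2) 0) * sqrt 2.
Proof.
rewrite quartic_patch_frame. unfold patch_uvw. rewrite norm_frame.
rewrite <- (sqrt_pow2 (Rabs _ * sqrt 2)).
2:{ apply Rmult_le_pos; [apply Rabs_pos | apply sqrt_pos]. }
f_equal. rewrite Rpow_mult_distr, pow2_abs, pow2_sqrt by lra.
unfold coord. field.
Qed.

Lemma norm_patch_center (q : params) :
  norm (quartic_patch c_oct q (1 / 3) (1 / 3)) = Rabs (coord q (1 / 3) (1 / 3) (1 / 3)) * sqrt 3.
Proof.
rewrite quartic_patch_frame. unfold patch_uvw. rewrite norm_frame.
rewrite <- (sqrt_pow2 (Rabs _ * sqrt 3)).
2:{ apply Rmult_le_pos; [apply Rabs_pos | apply sqrt_pos]. }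
f_equal. rewrite Rpow_mult_distr, pow2_abs, pow2_sqrt by lra.
unfold coord. field.
Qed.

Lemma norm_patch_range (g u v : R) : 7751 / 10000 <= g <= 7752 / 10000 -> Delta u v ->
  (1 + 6 * g) / 8 * sqrt 2 <= norm (quartic_patch c_oct (params_of_gamma c_oct g) u v)
    <= (8 * g - 1) / 9 * sqrt 3.
Proof.
intros Hg ([Hu1 Hu2] & [Hv1 Hv2] & Hw).
rewrite norm_patch_sym.
set (w := 1 - u - v). assert (Hw' : 0 <= w) by (unfold w; lra).
assert (S : u + v + w = 1) by (unfold w; ring).
set (e := u * v + v * w + w * u). set (f := u * v * w).
assert (He : 0 <= e <= 1 / 3).
{ split; [| now apply e2_le_third].
  pose proof (Rmult_le_pos u v). pose proof (Rmult_le_pos v w).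
  pose proof (Rmult_le_pos w u). unfold e; lra. }
assert (Hf : 0 <= f) by (repeat apply Rmult_le_pos; auto).
assert (Hfe : 3 * f <= e ^ 2) by now apply e3_le.
assert (Hsch : (4 * e - 1) * (1 - e) <= 6 * f) by now apply schur4.
assert (Hk : 3488 / 10000 <= 5 - 6 * g <= 3494 / 10000) by lra.
rewrite <- (sqrt_pow2 ((1 + 6 * g) / 8)), <- (sqrt_pow2 ((8 * g - 1) / 9)) by lra.
rewrite <- !sqrt_mult_alt by apply pow2_ge_0.
split; apply sqrt_le_1_alt.
(* For [k = 5 - 6 * g] one has [6 - k = 1 + 6 * g] and [17 - 4 * k = 3 * (8 * g - 1)]. *)
- pose proof (sqnorm_sym_ge (5 - 6 * g) e f Hk He Hf Hfe Hsch). lra.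
- pose proof (sqnorm_sym_le (5 - 6 * g) e f Hk He Hf Hfe). lra.
Qed.

(* [phi (norm p)] is the error; [eps] is its common value at the edge midpoints and at the
   centre of the optimal patch.  Raising the parameter raises the norm at the centre, lowering
   it lowers the norm at the edge midpoints. *)
Lemma equioscillation_optimal (phi : R -> R) (g eps : R) :
  7751 / 10000 <= g <= 7752 / 10000 ->
  (forall K, exists B, forall n, 0 <= n <= K -> phi n <= B) ->
  (forall n, (1 + 6 * g) / 8 * sqrt 2 <= n <= (8 * g - 1) / 9 * sqrt 3 -> phi n <= eps) ->
  (forall n, 0 <= n <= (1 + 6 * g) / 8 * sqrt 2 -> eps <= phi n) ->
  (forall n, (8 * g - 1) / 9 * sqrt 3 <= n -> eps <= phi n) ->
  attains_min_at c_oct (fun p => max_Delta (fun u v => phi (norm (p u v))))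
    (params_of_gamma c_oct g).
Proof.
intros Hg Hbd Hin Hlow Hhigh. split; [apply admissible_params_of_gamma; lra |].
intros q Hq. apply Rle_trans with eps.
{ apply max_Delta_le. intros u v Huv. apply Hin. now apply norm_patch_range. }
destruct (norm_patch_bound q) as [K HK]. destruct (Hbd K) as [B HB].
assert (Hmax : forall u v, Delta u v -> phi (norm (quartic_patch c_oct q u v)) <=
  max_Delta (fun u v => phi (norm (quartic_patch c_oct q u v)))).
{ intros u v. apply (Delta_le_max (fun u v => phi (norm (quartic_patch c_oct q u v))) B).
  intros u' v' H. apply HB. now apply HK. }
pose proof (Hmax (1 / 2) (1 / 2) ltac:(unfold Delta; lra)) as Hm.
pose proof (Hmax (1 / 3) (1 / 3) ltac:(unfold Delta; lra)) as Hc.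
rewrite norm_patch_midpoint in Hm. rewrite norm_patch_center in Hc.
destruct (admissible_midpoint_center q Hq) as (g' & E1 & E2). rewrite E1 in Hm. rewrite E2 in Hc.
pose proof (sqrt_pos 2). pose proof (sqrt_pos 3).
destruct (Rle_lt_dec (Rabs ((1 + 6 * g') / 8)) ((1 + 6 * g) / 8)) as [L | L].
- eapply Rle_trans; [| exact Hm]. apply Hlow. split.
  + apply Rmult_le_pos; [apply Rabs_pos | assumption].
  + now apply Rmult_le_compat_r.
- eapply Rle_trans; [| exact Hc]. apply Hhigh. apply Rmult_le_compat_r; [assumption |].
  (* Either [g' > g], or [1 + 6 * g'] is negative and [g' < - g - 1 / 3]; both make the norm at the
     centre larger. *)
  revert L. unfold Rabs. destruct (Rcase_abs _), (Rcase_abs _); lra.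
Qed.

Theorem mainTheorem6 :
  let c := sqrt 6 / 3 in
  attains_min_at c d_s
    (params_of_gamma c ((47 + 36 * sqrt 974) / 1510)) /\
  attains_min_at c d_r
    (params_of_gamma c
       (1 / 538 * (209 + 768 * sqrt 3 - 12 * sqrt (6126 + 1512 * sqrt 3)))).
Proof.
intros c.
assert (H2 : sqrt 2 ^ 2 = 2) by (apply pow2_sqrt; lra).
assert (H3 : sqrt 3 ^ 2 = 3) by (apply pow2_sqrt; lra).
assert (P2 : 0 < sqrt 2) by (apply sqrt_lt_R0; lra).
assert (P3 : 0 < sqrt 3) by (apply sqrt_lt_R0; lra).
split.
- assert (HR : sqrt 974 ^ 2 = 974) by (apply pow2_sqrt; lra).
  pose proof (sqrt_pos 974). set (r := sqrt 974) in *.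
  set (g := (47 + 36 * r) / 1510).
  assert (Hg : 7751 / 10000 <= g <= 7752 / 10000).
  { assert (312056 / 10000 <= r <= 312097 / 10000) by (split; nra). unfold g; lra. }
  (* Opposite errors at midpoint and centre: a quadratic equation whose positive root is the stated
     [g]. *)
  assert (Hosc : (1 + 6 * g) ^ 2 / 32 + (8 * g - 1) ^ 2 / 27 = 2).
  { unfold g. lra. }
  assert (HE : ((1 + 6 * g) / 8 * sqrt 2) ^ 2 = (1 + 6 * g) ^ 2 / 32)
    by (rewrite Rpow_mult_distr, H2; field).
  assert (HC : ((8 * g - 1) / 9 * sqrt 3) ^ 2 = (8 * g - 1) ^ 2 / 27)
    by (rewrite Rpow_mult_distr, H3; field).
  assert (E0 : 0 <= (1 + 6 * g) / 8 * sqrt 2) by (apply Rmult_le_pos; lra).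
  assert (C0 : 0 <= (8 * g - 1) / 9 * sqrt 3) by (apply Rmult_le_pos; lra).
  assert (0 <= (8 * g - 1) ^ 2 / 27 - 1) by nra.
  apply (equioscillation_optimal (fun n => Rabs (n ^ 2 - 1)) g ((8 * g - 1) ^ 2 / 27 - 1)); auto.
  + intros K. exists (K ^ 2 + 1). intros n Hn. apply Rabs_le.
    pose proof (pow_incr n K 2 Hn). pose proof (pow2_ge_0 n). lra.
  + intros n [Hn1 Hn2]. apply Rabs_le.
    pose proof (pow_incr _ n 2 (conj E0 Hn1)).
    pose proof (pow_incr n _ 2 (conj (Rle_trans _ _ _ E0 Hn1) Hn2)). lra.
  + intros n Hn. pose proof (pow_incr _ _ 2 Hn). rewrite Rabs_left1; lra.
  + intros n Hn. assert (Hn0 := pow_incr _ n 2 (conj C0 Hn)).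
    rewrite Rabs_right; lra.
(* The nested radical is [sqrt 2 * (54 + 7 * sqrt 3)]. *)
- assert (HR : sqrt (6126 + 1512 * sqrt 3) = 54 * sqrt 2 + 7 * sqrt 2 * sqrt 3).
  { rewrite <- (sqrt_pow2 (54 * sqrt 2 + 7 * sqrt 2 * sqrt 3)) by nra. f_equal.
    replace ((54 * sqrt 2 + 7 * sqrt 2 * sqrt 3) ^ 2) with
      (sqrt 2 ^ 2 * (2916 + 756 * sqrt 3 + 49 * sqrt 3 ^ 2)) by ring.
    rewrite H2, H3. ring. }
  rewrite HR.
  set (g := 1 / 538 * _).
  (* Without squares the balance equation is linear in [g]; the stated value is its solution with
     rationalised denominator. *)
  assert (Hosc : (1 + 6 * g) / 8 * sqrt 2 + (8 * g - 1) / 9 * sqrt 3 = 2).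
  { unfold g. nra. }
  assert (Hg : 7751 / 10000 <= g <= 7752 / 10000).
  { assert (14142 / 10000 <= sqrt 2 <= 14143 / 10000) by nra.
    assert (17320 / 10000 <= sqrt 3 <= 17321 / 10000) by nra. nra. }
  assert (E0 : 0 <= (1 + 6 * g) / 8 * sqrt 2) by (apply Rmult_le_pos; lra).
  assert (0 <= (8 * g - 1) / 9 * sqrt 3 - 1) by nra.
  apply (equioscillation_optimal (fun n => Rabs (n - 1)) g ((8 * g - 1) / 9 * sqrt 3 - 1)); auto.
  + intros K. exists (K + 1). intros n Hn. apply Rabs_le. lra.
  + intros n Hn. apply Rabs_le. lra.
  + intros n Hn. rewrite Rabs_left1; lra.
  + intros n Hn. rewrite Rabs_right; lra.
Qed.
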